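(* Let $\mathfrak{s}\in\{+1,-1\}$ be fixed, let $\Gamma=(V,E)$ be a finite simple graph, and let $(\Phi,\omega)$ be an oriented $\mathbb{T}^{\mathfrak{s}}$-gain graph with underlying graph $\Gamma$. Let $\mathrm{H}(\Phi,\omega)$ be its incidence matrix, and let $A(\Phi(\omega_\Lambda),\omega_\Lambda)$ be the adjacency matrix of the line graph $(\Phi(\omega_\Lambda),\omega_\Lambda)$ of $(\Phi,\omega)$ (both $\mathrm{H}^*\mathrm{H}$ and $A$ indexed by $E\times E$). Then $$\mathrm{H}(\Phi,\omega)^*\,\mathrm{H}(\Phi,\omega)=2I+\mathfrak{s}\,A(\Phi(\omega_\Lambda),\omega_\Lambda),$$ where $^*$ denotes conjugate transpose and $I$ is the identity matrix.
   Context: All graphs are finite and simple. $\mathbb{T}=\{z\in\mathbb{C}:|z|=1\}$ under multiplication; $\mathbb{T}^{\mathfrak{s}}$ denotes the group $\mathbb{T}$ together with the distinguished element $\mathfrak{s}\in\{+1,-1\}$ (which satisfies $\mathfrak{s}^2=1$). For an edge $e=v_iv_j$ of a graph $\Gamma=(V,E)$, write $e_{ij}$ both for the edge and for the oriented edge from $v_i$ to $v_j$. A $\mathbb{T}^{\mathfrak{s}}$-gain graph $\Phi=(\Gamma,\phi)$ is a graph $\Gamma$ with a function $\phi$ from the oriented edges (two opposite orientations for each edge) to $\mathbb{T}$ with $\phi(e_{ij})=\phi(e_{ji})^{-1}$. An incidence phase function on $\Gamma$ is a function $\omega:V\times E\to\mathbb{T}\cup\{0\}$ with $\omega(v,e)\neq0$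 if $v$ is incident to $e$ and $\omega(v,e)=0$ otherwise. The gain graph $\Phi(\omega)$ associated to $\omega$ has gains $$\phi(e_{ij})=\omega(v_i,e_{ij})\cdot\mathfrak{s}\cdot\omega(v_j,e_{ij})^{-1}.$$ An orientation of $\Phi$ is an incidence phase function $\omega$ with $\Phi(\omega)=\Phi$, and an oriented $\mathbb{T}^{\mathfrak{s}}$-gain graph is a pair $(\Phi,\omega)$ with $\omega$ an orientation of $\Phi$. Let $\Lambda_\Gamma$ be the usual line graph of $\Gamma$ (vertices are the edges of $\Gamma$; two distinct edges are adjacent iff they share an endpoint). Given $\omega$ on $\Gamma$, define an incidence phase function $\omega_\Lambda$ on $\Lambda_\Gamma$ as follows: if $e,f$ are distinct edges of $\Gamma$ sharing the (unique) vertex $v$, then for the edge $ef$ of $\Lambda_\Gamma$ set $\omega_\Lambda(e,ef)=\omega(v,e)^{-1}$ and $\omega_\Lambda(f,ef)=\omega(v,f)^{-1}$; $\omega_\Lambda$ is $0$ on non-incident pairs. The line graph of $(\Phi,\omega)$ is the oriented gain graph $(\Phi(\omega_\Lambda),\omega_\Lambda)$, where the gains of $\Phi(\omega_\Lambda)$ on $\Lambda_\Gamma$ are computed from $\omega_\Lambda$ by the displayed formula with the same $\mathfrak{s}$. The incidence matrix $\mathrm{H}(\Phi,\omega)$ is the $V\times E$ matrix with $(v,e)$ entry $\omega(v,e)$. The adjacency matrix of a gain graph with gain function $\phi$ has $(i,j)$ entry $\phi(e_{ij})$ if the $i$-th and $j$-th vertices are adjacent and $0$ otherwise; $A(\Phi(\omega_\Lambda),\omega_\Lambda)$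 is the adjacency matrix of $\Phi(\omega_\Lambda)$. *)

(* Defs.v *)
From mathcomp Require Import all_boot all_order all_algebra reals complex.

Set Implicit Arguments.
Unset Strict Implicit.
Unset Printing Implicit Defensive.

Import Order.TTheory GRing.Theory Num.Theory.
Local Open Scope ring_scope.
Local Open Scope sesquilinear_scope.
Local Open Scope complex_scope.

Record sgraph := SGraph {
  vertex :> finType;
  adj : rel vertex;
  adj_sym : symmetric adj;
  adj_irr : irreflexive adj }.

Definition edge_set (G : sgraph) : {set {set G}} :=
  [set e : {set G} | [exists x : G, exists y : G, adj x y && (e == [set x; y])]].

Definition edge (G : sgraph) : finType := {e : {set G} | e \in edge_set G}.

Definition incident (G : sgraph) (v : G) (e : edge G) : bool := v \in sval e.

(* Oriented edges: p stands for the edge p.1 p.2 directed from p.1 to p.2. *)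
Definition dart (G : sgraph) : finType := {p : G * G | adj p.1 p.2}.
Definition src (G : sgraph) (d : dart G) : G := (sval d).1.
Definition tgt (G : sgraph) (d : dart G) : G := (sval d).2.

Lemma dart_rev_subproof (G : sgraph) (d : dart G) : adj (tgt d) (src d).
Proof. by rewrite adj_sym; exact: (svalP d). Qed.

Definition dart_rev (G : sgraph) (d : dart G) : dart G :=
  exist (fun p : G * G => adj p.1 p.2) (tgt d, src d) (dart_rev_subproof d).

Lemma dart_edge_subproof (G : sgraph) (d : dart G) :
  [set src d; tgt d] \in edge_set G.
Proof.
rewrite inE; apply/existsP; exists (src d); apply/existsP; exists (tgt d).
by rewrite eqxx andbT; exact: (svalP d).
Qed.

Definition dart_edge (G : sgraph) (d : dart G) : edge G :=
  exist (fun e : {set G} => e \in edge_set G) _ (dart_edge_subproof d).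

Definition line_adj (G : sgraph) : rel (edge G) :=
  fun e f => (e != f) && [exists v : G, incident v e && incident v f].

Lemma line_adj_sym (G : sgraph) : symmetric (@line_adj G).
Proof.
move=> e f; rewrite /line_adj eq_sym; congr (_ && _).
by apply: eq_existsb => v; rewrite andbC.
Qed.

Lemma line_adj_irr (G : sgraph) : irreflexive (@line_adj G).
Proof. by move=> e; rewrite /line_adj eqxx. Qed.

Definition line_sgraph (G : sgraph) : sgraph :=
  SGraph (@line_adj_sym G) (@line_adj_irr G).

Record sgn (R : realType) := Sgn {
  sgn_val :> R[i];
  sgnP : sgn_val = 1 \/ sgn_val = -1 }.

Lemma norm_sgn (R : realType) (s : sgn R) : `|s : R[i]| = 1.
Proof. by case: s => s /= [] ->; rewrite ?normrN normr1. Qed.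

Lemma invr_sgn (R : realType) (s : sgn R) : (s : R[i])^-1 = s.
Proof. by case: s => s /= [] ->; rewrite ?invrN invr1. Qed.

Record gain_graph (R : realType) (G : sgraph) := GainGraph {
  gain :> dart G -> R[i];
  norm_gain : forall d, `|gain d| = 1;
  gain_rev : forall d, gain (dart_rev d) = (gain d)^-1 }.

Record incidence_phase (R : realType) (G : sgraph) := IncidencePhase {
  phase :> G -> edge G -> R[i];
  norm_phase : forall v e, incident v e -> `|phase v e| = 1;
  phase_out : forall v e, ~~ incident v e -> phase v e = 0 }.

Section AssociatedGainGraph.
Variables (R : realType) (s : sgn R) (G : sgraph) (w : incidence_phase R G).

Definition assoc_gain (d : dart G) : R[i] :=
  w (src d) (dart_edge d) * s * (w (tgt d) (dart_edge d))^-1.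

Lemma norm_assoc_gain d : `|assoc_gain d| = 1.
Proof.
rewrite /assoc_gain !normrM normfV norm_sgn.
rewrite !norm_phase ?invr1 ?mulr1 //; by rewrite /incident /= !inE eqxx ?orbT.
Qed.

Lemma assoc_gain_rev d : assoc_gain (dart_rev d) = (assoc_gain d)^-1.
Proof.
have -> : assoc_gain (dart_rev d) =
    w (tgt d) (dart_edge d) * s * (w (src d) (dart_edge d))^-1.
  rewrite /assoc_gain; suff -> : dart_edge (dart_rev d) = dart_edge d by [].
  by apply: val_inj; rewrite /= setUC.
by rewrite /assoc_gain !invfM invrK invr_sgn [LHS]mulrC [w _ _ * s]mulrC mulrA.
Qed.

Definition assoc_gain_graph : gain_graph R G :=
  GainGraph norm_assoc_gain assoc_gain_rev.

End AssociatedGainGraph.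

(* Phi(w) = Phi; for functions of darts this is pointwise equality of gains. *)
Definition is_orientation (R : realType) (s : sgn R) (G : sgraph)
    (Phi : gain_graph R G) (w : incidence_phase R G) : Prop :=
  forall d : dart G, assoc_gain_graph s w d = Phi d.

Record oriented_gain_graph (R : realType) (s : sgn R) (G : sgraph) :=
  OrientedGainGraph {
    og_gain : gain_graph R G;
    og_phase : incidence_phase R G;
    og_orientation : is_orientation s og_gain og_phase }.

Section LineGraph.
Variables (R : realType) (G : sgraph) (w : incidence_phase R G).

(* ef is an edge of the line graph, that is, a pair of distinct edges e, f of G
   with a common endpoint v, which is unique because G is simple. *)
Definition common_vertex (ef : edge (line_sgraph G)) : option G :=
  [pick v : G | [forall e : edge G, incident (e : line_sgraph G) ef ==> incident v e]].

Definition line_phase_fun (e : line_sgraph G) (ef : edge (line_sgraph G)) : R[i] :=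
  if incident e ef then
    if common_vertex ef is Some v then (w v e)^-1 else 0
  else 0.

Lemma norm_line_phase e ef : incident e ef -> `|line_phase_fun e ef| = 1.
Proof.
move=> e_ef; rewrite /line_phase_fun e_ef /common_vertex.
case: pickP => [v /forallP/(_ e)|nov].
  by rewrite e_ef /= => ve; rewrite normfV norm_phase // invr1.
have /[!inE]/existsP[x /existsP[y /andP[xy /eqP def_ef]]] := svalP ef.
have /existsP[v /andP[vx vy]] := proj2 (andP xy).
have /negP[] := nov v; apply/forallP => f; apply/implyP.
by rewrite /incident def_ef !inE => /orP[] /eqP ->.
Qed.

Lemma line_phase_out e ef : ~~ incident e ef -> line_phase_fun e ef = 0.
Proof. by rewrite /line_phase_fun => /negbTE->. Qed.

Definition line_phase : incidence_phase R (line_sgraph G) :=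
  IncidencePhase norm_line_phase line_phase_out.

End LineGraph.

Definition line_graph (R : realType) (s : sgn R) (G : sgraph)
    (PhiW : oriented_gain_graph s G) : oriented_gain_graph s (line_sgraph G) :=
  @OrientedGainGraph R s (line_sgraph G)
    (assoc_gain_graph s (line_phase (og_phase PhiW)))
    (line_phase (og_phase PhiW))
    (fun=> erefl).

(* Rows and columns are indexed through the enumerations of the vertex and edge
   types. *)
Definition incidence_mx (R : realType) (s : sgn R) (G : sgraph)
    (PhiW : oriented_gain_graph s G) : 'M[R[i]]_(#|G|, #|edge G|) :=
  \matrix_(i, j) og_phase PhiW (enum_val i) (enum_val j).

Definition adjacency_mx (R : realType) (G : sgraph) (Phi : gain_graph R G) :
    'M[R[i]]_#|G| :=
  \matrix_(i, j)
    if insub (enum_val i, enum_val j) is Some d then Phi d else 0.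

(* Main.v *)
Require Import Defs.
From mathcomp Require Import all_boot all_order all_algebra reals complex.
Import Order.TTheory GRing.Theory Num.Theory.
Local Open Scope ring_scope.
Local Open Scope sesquilinear_scope.
Local Open Scope complex_scope.

(** The [(e, f)] entry of [H^* H] is the sum over the vertices [v] of
    [(w v e)^* w v f], which only the endpoints shared by [e] and [f] contribute
    to.

    If [e = f], both endpoints contribute [|w v e|^2 = 1]: this is the [2 I]
    ([card_edge], [phase_gram_diag]).  If [e <> f], simplicity of the graph
    leaves at most one shared endpoint [v] ([common_endpoint_uniq]).  When there
    is none, [e] and [f] are not adjacent in the line graph and both sides
    vanish.  When there is one, the sum is [(w v e)^* w v f = (w v e)^-1 w v f],
    as phases are unimodular ([phase_gram_offdiag]).  The line graph inverts
    phases, so that its gain from [e] to [f] is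
    [(w v e)^-1 s ((w v f)^-1)^-1] ([line_gainE]): exactly the same quantity up
    to the factor [s], which the coefficient [s] of the adjacency matrix cancels
    since [s^2 = 1]. *)

Lemma card_edge (G : sgraph) (e : edge G) : #|sval e| = 2%N.
Proof.
case: e => /= e; rewrite inE => /existsP[x /existsP[y /andP[xy /eqP->]]].
by rewrite cards2; case: eqVneq xy => // ->; rewrite adj_irr.
Qed.

(** Two distinct vertices on both edges would exhaust each of the two-element
    sets, making the edges equal. *)
Lemma common_endpoint_uniq (G : sgraph) (e f : edge G) (u v : G) :
  e != f -> incident u e -> incident u f -> incident v e -> incident v f ->
  u = v.
Proof.
move=> /eqP ne_ef ue uf ve vf; case: (eqVneq u v) => // ne_uv; case: ne_ef.
have spanned (g : edge G) : incident u g -> incident v g ->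
    [set u; v] = sval g.
  move=> ug vg; apply/eqP; rewrite eqEcard card_edge cards2 ne_uv andbT.
  by apply/subsetP => x; rewrite !inE => /orP[] /eqP->.
by apply: val_inj; rewrite /= -(spanned e ue ve) (spanned f uf vf).
Qed.

Lemma conjC_unimodular (C : numClosedFieldType) (z : C) :
  `|z| = 1 -> (z^*)%R = z^-1.
Proof. by move=> z1; rewrite invC_norm z1 expr1n invr1 mul1r. Qed.

Lemma sgn_sq (R : realType) (s : sgn R) : (s : R[i]) * s = 1.
Proof. by rewrite -{1}invr_sgn mulVf // -normr_gt0 norm_sgn. Qed.

Lemma phase_gram_diag (R : realType) (G : sgraph) (w : incidence_phase R G)
    (e : edge G) : \sum_v ((w v e)^*)%R * w v e = 2.
Proof.
rewrite (bigID (fun v => incident v e)) /= [X in _ + X]big1 ?addr0; last first.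
  by move=> v ve; rewrite (phase_out w ve) mulr0.
rewrite (eq_bigr (fun=> 1)) => [|v ve].
  by rewrite sumr_const -(card_edge _ e); congr (_ *+ _); apply: eq_card.
by rewrite mulrC -normCK (norm_phase w ve) expr1n.
Qed.

Lemma phase_gram_offdiag (R : realType) (G : sgraph) (w : incidence_phase R G)
    (e f : edge G) (v : G) :
  e != f -> incident v e -> incident v f ->
  \sum_u ((w u e)^*)%R * w u f = (w v e)^-1 * w v f.
Proof.
move=> ne_ef ve vf; rewrite (bigD1 v) //= big1 ?addr0 => [|u ne_uv].
  by rewrite conjC_unimodular ?norm_phase.
case ue: (incident u e); last by rewrite (phase_out w (negbT ue)) conjC0 mul0r.
case uf: (incident u f); last by rewrite (phase_out w (negbT uf)) mulr0.
by rewrite (common_endpoint_uniq _ _ _ _ _ ne_ef ue uf ve vf) eqxx in ne_uv.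
Qed.

(** The vertex picked by [common_vertex] for the line-graph edge [ef] can only
    be [v], so both line phases are read at [v]. *)
Lemma line_gainE (R : realType) (s : sgn R) (G : sgraph)
    (w : incidence_phase R G) (d : dart (line_sgraph G)) (v : G) :
  incident v (src d : edge G) -> incident v (tgt d : edge G) ->
  assoc_gain s (line_phase w) d =
    (s : R[i]) * ((w v (src d))^-1 * w v (tgt d)).
Proof.
move=> ve vf; have /andP[ne_ef _] : line_adj (src d) (tgt d) := svalP d.
have src_d : incident (src d) (dart_edge d) by rewrite /incident !inE eqxx.
have tgt_d : incident (tgt d) (dart_edge d) by rewrite /incident !inE eqxx orbT.
have pick_v : common_vertex (dart_edge d) = Some v.
  rewrite /common_vertex; case: pickP => [u /forallP u_all|/(_ v)/negP[]].
    congr Some; apply: common_endpoint_uniq ne_ef _ _ ve vf.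
      exact: (implyP (u_all _) src_d).
    exact: (implyP (u_all _) tgt_d).
  by apply/forallP => g; apply/implyP; rewrite /incident !inE => /orP[] /eqP->.
rewrite /assoc_gain /= /line_phase_fun src_d tgt_d pick_v invrK.
by rewrite mulrA (mulrC _^-1).
Qed.

Theorem theorem5p1 (R : realType) (s : sgn R) (G : sgraph)
    (PhiW : oriented_gain_graph s G) :
  (incidence_mx PhiW) ^t* *m incidence_mx PhiW =
  2 *: 1%:M + (s : R[i]) *: adjacency_mx (og_gain (line_graph PhiW)).
Proof.
apply/matrixP => i j; set w := og_phase PhiW.
have -> : ((incidence_mx PhiW) ^t* *m incidence_mx PhiW) i j =
    \sum_v ((w v (enum_val i))^*)%R * w v (enum_val j).
  rewrite mxE [RHS](reindex (@enum_val _ G)) /=; last first.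
    exact/onW_bij/enum_val_bij.
  by apply: eq_bigr => k _; rewrite !mxE.
rewrite !mxE -(inj_eq enum_val_inj).
case: insubP => [d adj_ij def_d|nadj_ij].
  have /andP[/= ne_ij /existsP[v /andP[vi vj]]] := adj_ij.
  have src_d : src d = enum_val i by rewrite /src def_d.
  have tgt_d : tgt d = enum_val j by rewrite /tgt def_d.
  rewrite (negbTE ne_ij) mulr0 add0r /= (line_gainE _ _ _ _ _ v) ?src_d ?tgt_d //.
  rewrite (phase_gram_offdiag _ _ _ _ _ v) //.
  by rewrite mulrA sgn_sq mul1r.
rewrite mulr0 addr0; case: eqVneq nadj_ij => [->|ne_ij] /= nadj_ij.
  by rewrite phase_gram_diag mulr1.
rewrite mulr0 big1 // => v _; rewrite /line_adj ne_ij /= in nadj_ij.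
have /negP := existsPn nadj_ij v.
case vi: (incident v _); last by rewrite (phase_out w (negbT vi)) conjC0 mul0r.
case vj: (incident v _) => // _; by rewrite (phase_out w (negbT vj)) mulr0.
Qed.
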